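(* Let $q$ be a complex number with $|q|<1$ and let $k\geqslant 1$ be an integer. Then $$\frac{(-q;q)_\infty}{(q;q)_\infty}\bigg(1+2\sum_{j=1}^k (-1)^j q^{j^2}\bigg) =1+(-1)^k \sum_{n=k+1}^\infty \frac{(-q;q)_{k}\, (-1;q)_{n-k}\,q^{(k+1)n}}{(q;q)_n}{n-1\brack k}_q.$$
   Context: The $q$-shifted factorials are $(a;q)_\infty=\prod_{n=0}^{\infty}(1-aq^n)$ and, for integers $M\geqslant 0$, $(a;q)_M=\dfrac{(a;q)_\infty}{(aq^M;q)_\infty}=\prod_{i=0}^{M-1}(1-aq^i)$. The $q$-binomial coefficient is, for integers $0\leqslant N\leqslant M$, ${M\brack N}_q=\dfrac{(q;q)_M}{(q;q)_N (q;q)_{M-N}}$. *)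

(* Defs.v *)
From HB Require Import structures.
From mathcomp Require Import all_boot all_order all_algebra.
From mathcomp Require Import all_classical all_reals all_analysis.
From mathcomp Require Import complex.
Set Implicit Arguments.
Unset Strict Implicit.
Unset Printing Implicit Defensive.
Import Order.TTheory GRing.Theory Num.Theory numFieldNormedType.Exports.
Local Open Scope classical_set_scope.
Local Open Scope ring_scope.
Local Open Scope complex_scope.

(* The library attaches the topology of the modulus to the alias R[i]^o only. *)
HB.instance Definition _ (R : realType) := NormedModule.copy R[i] R[i]^o.

Definition qpoch (K : fieldType) (a q : K) (M : nat) : K :=
  \prod_(i < M) (1 - a * q ^+ i).

Definition qpoch_inf (R : realType) (a q : R[i]) : R[i] :=
  limn (fun M => qpoch a q M).

(* Since M - N is truncated, this is the q-binomial only for N <= M. *)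
Definition qbinom (K : fieldType) (q : K) (M N : nat) : K :=
  qpoch q q M / (qpoch q q N * qpoch q q (M - N)).

(* Main.v *)
(** Write [c_m = (-q;q)_m / (q;q)_m], [F(i,j) = sum_m c_m q^(im) / (1 - q^(m+j))]
    and [B_i = sum_m c_m q^(im)].  Substituting [n = m + k + 1], the series of
    the statement becomes [2 c_k q^((k+1)^2) F(k+1,k+1)].  From
    [c_(m+1) (1 - q^(m+1)) = c_m (1 + q^(m+1))] one gets
      [B_i = F(i,j) - q^j F(i+1,j)],
      [F(i,j) - F(i+1,j) = q^i (F(i,j+1) + q F(i+1,j+1))],
      [(1 - q^i) B_i = (1 + q^(i+1)) B_(i+1)],
    and eliminating [F(k+1,k)] and [F(k,k+1)],
      [(1 - q^k) F(k,k) + q^(2k+1) (1 + q^k) F(k+1,k+1) = (1 - q^(2k)) B_k].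
    Since [(-q;q)_k B_k = A (q;q)_(k-1)] with [A = lim c_m], consecutive values
    of [k] differ by exactly the new theta term, and the induction starts from
    the telescoping sum [c_N = 1 + 2q sum_(m<N) c_m q^m / (1 - q^(m+1))]. *)

Require Import Defs.
From mathcomp Require Import all_boot all_order all_algebra.
From mathcomp Require Import all_classical all_reals all_analysis.
From mathcomp Require Import complex.
From mathcomp Require Import ring.
Import Order.TTheory GRing.Theory Num.Theory numFieldNormedType.Exports.
Local Open Scope classical_set_scope.
Local Open Scope ring_scope.
Local Open Scope complex_scope.

Set Implicit Arguments.
Unset Strict Implicit.
Unset Printing Implicit Defensive.

(** * Limits, q-products and truncated sums over an abstract field *)

Section Algebra.
Variable K : numFieldType.
Implicit Types (q : K) (u v : nat -> K).

Lemma cvgn_unique u (a b : K) : u @ \oo --> a -> u @ \oo --> b -> a = b.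
Proof. by move=> ha hb; apply: norm_cvg_unique ha hb. Qed.

Lemma cvgn_lim u (a : K) : u @ \oo --> a -> limn u = a.
Proof. by move/cvg_lim; apply. Qed.

Lemma cvgn_dist u (a : K) :
  (forall e : K, 0 < e -> \forall n \near \oo, `|a - u n| < e) -> u @ \oo --> a.
Proof. by move/cvgrPdist_lt. Qed.

Lemma cvgn_addl u (a b : K) : u @ \oo --> a -> (fun n => b + u n) @ \oo --> b + a.
Proof. by move=> hu; apply: cvgD => //; exact: cvg_cst. Qed.

Lemma cvgn_mul u v (a b : K) : u @ \oo --> a -> v @ \oo --> b ->
  (fun n => u n * v n) @ \oo --> a * b.
Proof. exact: cvgM. Qed.

Lemma qpoch0 (a q : K) : qpoch a q 0 = 1.
Proof. by rewrite /qpoch big_ord0. Qed.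

Lemma qpochS (a q : K) n : qpoch a q n.+1 = qpoch a q n * (1 - a * q ^+ n).
Proof. by rewrite /qpoch big_ord_recr. Qed.

Lemma qpoch_recl (a q : K) n : qpoch a q n.+1 = (1 - a) * qpoch (a * q) q n.
Proof.
rewrite /qpoch big_ord_recl expr0 mulr1; congr (_ * _).
by apply: eq_bigr => i _; rewrite lift0 exprS mulrA.
Qed.

Lemma qpoch_neq0 q n : (forall m, (0 < m)%N -> 1 - q ^+ m != 0) ->
  qpoch q q n != 0.
Proof. by move=> hq; apply/prodf_neq0 => i _; rewrite -exprS hq. Qed.

Definition qratio q n : K := qpoch (- q) q n / qpoch q q n.

Lemma qratio0 q : qratio q 0 = 1.
Proof. by rewrite /qratio !qpoch0 divr1. Qed.

(** With [qratio] as [c_m], this truncates [B_i], and [lambert_sum] truncates [F(i,j)]. The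
    recurrences are first proved as finite identities. *)
Definition qratio_sum q i N : K := \sum_(m < N) qratio q m * q ^+ (i * m).

Definition lambert_sum q i j N : K :=
  \sum_(m < N) qratio q m * q ^+ (i * m) / (1 - q ^+ (m + j)).

(** * Recurrences for the truncated sums *)

Section Identities.
Variable q : K.
Hypothesis hq : forall m, (0 < m)%N -> 1 - q ^+ m != 0.

Lemma qratioS n :
  qratio q n.+1 * (1 - q ^+ n.+1) = qratio q n * (1 + q ^+ n.+1).
Proof.
have hn := hq (ltn0Sn n); have hQ := qpoch_neq0 n hq.
by rewrite /qratio !qpochS -exprS mulNr -exprS; field; rewrite hn hQ.
Qed.

(** Write [1] as [(1 - q^(m+j)) / (1 - q^(m+j))] and split the numerator; its factor [q^m] raises
    [i] by one. *)
Lemma qratio_sum_lambert i j N : (0 < j)%N ->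
  qratio_sum q i N = lambert_sum q i j N - q ^+ j * lambert_sum q i.+1 j N.
Proof.
move=> j0; rewrite /qratio_sum /lambert_sum mulr_sumr -sumrB.
apply: eq_bigr => m _.
have hm : 1 - q ^+ (m + j) != 0 by rewrite hq// addn_gt0 j0 orbT.
move: hm; rewrite mulSn !exprD => hm; field; exact: hm.
Qed.

(** The difference puts a factor [1 - q^m] in each term. It kills [m = 0]; elsewhere [qratioS] turns
    [c_m (1 - q^m)] into [c_(m-1) (1 + q^m)]. Reindexing then shortens the sum by one term and
    raises [j]. *)
Lemma lambert_sum_shift i j N : (0 < j)%N ->
  lambert_sum q i j N.+1 - lambert_sum q i.+1 j N.+1 =
  q ^+ i * (lambert_sum q i j.+1 N + q * lambert_sum q i.+1 j.+1 N).
Proof.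
move=> j0; rewrite /lambert_sum -sumrB big_ord_recl /= !muln0 subrr add0r.
rewrite mulrDr !mulr_sumr -big_split /=; apply: eq_bigr => m _.
rewrite /bump leq0n add1n addSnnS.
set d := 1 - q ^+ (m + j.+1).
rewrite !mulSn !mulnS !exprD.
have := qratioS m; rewrite !exprS => hS.
transitivity (qratio q m.+1 * (1 - q * q ^+ m) * (q ^+ i * q ^+ (i * m)) / d).
  by ring.
by rewrite hS; ring.
Qed.

Lemma qratio_sum_shift i N :
  qratio_sum q i N.+1 - qratio_sum q i.+1 N.+1 =
  q ^+ i * (qratio_sum q i N + q * qratio_sum q i.+1 N).
Proof.
rewrite /qratio_sum -sumrB big_ord_recl /= !muln0 subrr add0r.
rewrite mulrDr !mulr_sumr -big_split /=; apply: eq_bigr => m _.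
rewrite /bump leq0n add1n !mulSn !mulnS !exprD.
have := qratioS m; rewrite !exprS => hS.
transitivity (qratio q m.+1 * (1 - q * q ^+ m) * (q ^+ i * q ^+ (i * m)));
  first by ring.
by rewrite hS; ring.
Qed.

(** By [qratioS], [c_(N+1) - c_N = 2 c_N q^(N+1) / (1 - q^(N+1))]. *)
Lemma qratio_telescope N : qratio q N = 1 + 2 * q * lambert_sum q 1 1 N.
Proof.
elim: N => [|N IH]; first by rewrite /lambert_sum big_ord0 mulr0 addr0 qratio0.
rewrite /lambert_sum big_ord_recr /= -/(lambert_sum q 1 1 N) mulrDr addrA -IH.
have hn := hq (ltn0Sn N).
rewrite mul1n addn1; apply: (mulIf hn); rewrite qratioS.
by rewrite mulrDl -!mulrA mulVf// exprS; ring.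
Qed.

(* The index of the series in the statement is [n = m + k.+1]. *)
Lemma summand_qratio k m :
  qpoch (- q) q k * qpoch (- 1) q (m + k.+1 - k) * q ^+ (k.+1 * (m + k.+1))
    / qpoch q q (m + k.+1) * qbinom q (m + k.+1).-1 k
  = 2 * qratio q k * q ^+ (k.+1 ^ 2)
    * (qratio q m * q ^+ (k.+1 * m) / (1 - q ^+ (m + k.+1))).
Proof.
(* The factor 2 comes from [(-1;q)_(m+1) = 2 (-q;q)_m]. *)
rewrite addnS subSn ?leq_addl// addnK /= /qbinom addnK qpoch_recl mulN1r.
rewrite qpochS -exprS opprK -addnS mulnDr -mulnn exprD /qratio.
have hm : 1 - q ^+ (m + k.+1) != 0 by rewrite hq// addnS.
have h1 := qpoch_neq0 m hq; have h2 := qpoch_neq0 k hq.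
have h3 := qpoch_neq0 (m + k) hq.
by rewrite addnS in hm *; field; rewrite hm h1 h2 h3.
Qed.

End Identities.

(** * Passage to the limit and induction on [k] *)

Section Limits.
Variables (q A : K).
Hypothesis hq : forall m, (0 < m)%N -> 1 - q ^+ m != 0.
Hypothesis qratio_cvg : qratio q @ \oo --> A.
Hypothesis lambert_cvg :
  forall i j, (0 < i)%N -> (0 < j)%N -> cvgn (lambert_sum q i j).

Let F i j := limn (lambert_sum q i j).
Let B i := limn (qratio_sum q i).

Let cvF i j : (0 < i)%N -> (0 < j)%N -> lambert_sum q i j @ \oo --> F i j.
Proof. exact: lambert_cvg. Qed.

Let cvgB_F i j : (0 < i)%N -> (0 < j)%N ->
  qratio_sum q i @ \oo --> F i j - q ^+ j * F i.+1 j.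
Proof.
move=> i0 j0.
rewrite (_ : qratio_sum q i = fun N =>
   lambert_sum q i j N - q ^+ j * lambert_sum q i.+1 j N).
  by apply: cvgB; [exact: cvF | apply: cvgMr; exact: cvF].
by apply/funext => N; exact: qratio_sum_lambert.
Qed.

Let limB_F i j : (0 < i)%N -> (0 < j)%N -> B i = F i j - q ^+ j * F i.+1 j.
Proof. by move=> i0 j0; apply: cvgn_lim; exact: cvgB_F. Qed.

Let cvB i : (0 < i)%N -> qratio_sum q i @ \oo --> B i.
Proof. by move=> i0; rewrite (limB_F i0 (ltn0Sn 0)); exact: cvgB_F. Qed.

Let F_shift i j : (0 < i)%N -> (0 < j)%N ->
  F i j - F i.+1 j = q ^+ i * (F i j.+1 + q * F i.+1 j.+1).
Proof.
move=> i0 j0.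
apply: (@cvgn_unique (fun N => lambert_sum q i j N.+1 - lambert_sum q i.+1 j N.+1)).
  by apply: cvgB; rewrite (cvg_shiftS (lambert_sum _ _ _)); exact: cvF.
under eq_fun do rewrite lambert_sum_shift//.
by apply: cvgMr; apply: cvgD; [exact: cvF | apply: cvgMr; exact: cvF].
Qed.

Let B_shift i : (0 < i)%N -> B i - B i.+1 = q ^+ i * (B i + q * B i.+1).
Proof.
move=> i0.
apply: (@cvgn_unique (fun N => qratio_sum q i N.+1 - qratio_sum q i.+1 N.+1)).
  by apply: cvgB; rewrite (cvg_shiftS (qratio_sum _ _)); exact: cvB.
under eq_fun do rewrite qratio_sum_shift//.
by apply: cvgMr; apply: cvgD; [exact: cvB | apply: cvgMr; exact: cvB].
Qed.

Let B1 : A = B 1 * (1 + q).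
Proof.
apply: (@cvgn_unique (qratio q)) => //.
rewrite (_ : qratio q = fun N => qratio_sum q 1 N.+1 + q * qratio_sum q 1 N).
  rewrite mulrDr mulr1 [_ * q]mulrC.
  apply: cvgD; first by rewrite (cvg_shiftS (qratio_sum _ _)); exact: cvB.
  by apply: cvgMr; exact: cvB.
apply/funext => N; have := qratio_sum_shift hq 0 N.
rewrite {1}/qratio_sum big_ord_recr /= mul0n expr0 !mulr1 mul1r.
rewrite -/(qratio_sum q 0 N) => h.
by apply: (addrI (qratio_sum q 0 N)); rewrite addrCA -h; ring.
Qed.

(** Iterate [B_shift] from [B1]. This is the q-binomial theorem at the argument [q^(k+1)]. *)
Let B_qpoch k : qpoch (- q) q k.+1 * B k.+1 = A * qpoch q q k.
Proof.
elim: k => [|k IH].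
  by rewrite qpochS !qpoch0 expr0 B1; ring.
rewrite qpochS [qpoch q q _]qpochS mulrA -IH -exprS.
have := B_shift (ltn0Sn k); rewrite !exprS => h.
transitivity (qpoch (- q) q k.+1 *
  (B k.+2 + q * q ^+ k * (q * B k.+2))); first by ring.
have -> : q * q ^+ k * (q * B k.+2) = B k.+1 - B k.+2 - q * q ^+ k * B k.+1.
  by rewrite h; ring.
by ring.
Qed.

Let F_step k : (0 < k)%N ->
  (1 - q ^+ k) * F k k + q ^+ k.*2.+1 * (1 + q ^+ k) * F k.+1 k.+1
  = (1 - q ^+ k) * (1 + q ^+ k) * B k.
Proof.
move=> k0; have h1 := limB_F k0 k0.
have h2 := limB_F k0 (ltn0Sn k); have h3 := F_shift k0 k0.
have e1 : q ^+ k * F k.+1 k = F k k - B k by rewrite h1; ring.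
have e2 : F k k.+1 = B k + q * q ^+ k * F k.+1 k.+1.
  by rewrite h2 exprS; ring.
(* The extra factor [q^k] lets [F(k+1,k)] enter only as [q^k F(k+1,k)], which avoids dividing by
   [q^k] when [q = 0]. *)
have : q ^+ k * (F k k - F k.+1 k) =
   q ^+ k * q ^+ k * (F k k.+1 + q * F k.+1 k.+1) by rewrite h3; ring.
rewrite mulrBr e1 e2 exprS -addnn exprD => /eqP; rewrite -subr_eq0 => /eqP h.
apply/eqP; rewrite -subr_eq0; apply/eqP.
by rewrite -[RHS]oppr0 -h; ring.
Qed.

Lemma theta_lambert k :
  1 + (-1) ^+ k * (2 * qratio q k * q ^+ (k.+1 ^ 2) * F k.+1 k.+1)
  = A * (1 + 2 * \sum_(1 <= j < k.+1) (-1) ^+ j * q ^+ (j ^ 2)).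
Proof.
elim: k => [|k IH].
  (* At [k = 0] the theta sum is empty and the claim is the limit of [qratio_telescope]. *)
  rewrite big_geq// qratio0 expr0 exp1n expr1 mulr0 addr0 !mulr1 mul1r.
  symmetry; apply: (@cvgn_unique (qratio q)) => //.
  rewrite (_ : qratio q = fun N => 1 + 2 * q * lambert_sum q 1 1 N).
    by apply: cvgD; [exact: cvg_cst | apply: cvgMr; exact: cvF].
  by apply/funext => N; exact: qratio_telescope.
rewrite big_nat_recr//= [2 * (_ + _)]mulrDr addrA mulrDr -IH.
have hK := hq (ltn0Sn k); have hQ := qpoch_neq0 k hq.
have hF := F_step (ltn0Sn k); have hB := B_qpoch k.
have hr : qratio q k.+1 = qratio q k * (1 + q ^+ k.+1) / (1 - q ^+ k.+1).
  by apply: (mulIf hK); rewrite qratioS// divfK.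
(* In this form of [A], the new theta term matches the [B] term of [F_step]. *)
have hA : A = qratio q k * (1 + q ^+ k.+1) * B k.+1.
  rewrite /qratio; apply: (mulIf hQ); rewrite -hB qpochS exprS.
  by field.
(* The gap between consecutive squares is the exponent of [q] in [F_step]. *)
have -> : (k.+2 ^ 2 = k.+1 ^ 2 + k.+1.*2.+1)%N.
  by rewrite -addnn -!mulnn; ring.
have -> : q ^+ (k.+1 ^ 2 + k.+1.*2.+1) = q ^+ (k.+1 ^ 2) * q ^+ k.+1.*2.+1.
  exact: exprD.
rewrite hr [(-1) ^+ k.+1]exprS.
have {}hF : q ^+ k.+1.*2.+1 * (1 + q ^+ k.+1) * F k.+2 k.+2
   = (1 - q ^+ k.+1) * ((1 + q ^+ k.+1) * B k.+1 - F k.+1 k.+1).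
  by apply: (addrI ((1 - q ^+ k.+1) * F k.+1 k.+1)); rewrite hF; ring.
transitivity (1 - (-1) ^+ k * 2 * qratio q k * q ^+ (k.+1 ^ 2) *
   (q ^+ k.+1.*2.+1 * (1 + q ^+ k.+1) * F k.+2 k.+2) / (1 - q ^+ k.+1)).
  by ring.
rewrite hF {}hA.
by field.
Qed.

Lemma summand_cvg k :
  (fun N => \sum_(k.+1 <= n < N)
    (qpoch (- q) q k * qpoch (- 1) q (n - k) * q ^+ (k.+1 * n) / qpoch q q n
     * qbinom q n.-1 k)) @ \oo -->
  2 * qratio q k * q ^+ (k.+1 ^ 2) * F k.+1 k.+1.
Proof.
(* At [N + k.+1] the sum has exactly [N] terms, one for each [m < N]. *)
set s := (X in X @ _ --> _); rewrite -(cvg_shiftn k.+1 s).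
rewrite (_ : (fun N => _) = fun N =>
    2 * qratio q k * q ^+ (k.+1 ^ 2) * lambert_sum q k.+1 k.+1 N).
  by apply: cvgMr; exact: cvF.
apply/funext => N; rewrite /s -{1}[k.+1]add0n big_addn addnK big_mkord.
by rewrite mulr_sumr; apply: eq_bigr => m _; exact: summand_qratio.
Qed.

End Limits.
End Algebra.

(** * Geometric domination for complex series and products *)

Section ComplexConvergence.
Variable R : realType.
Implicit Types (u a : nat -> R[i]) (C r : R).

Lemma normc_i : `|'i : R[i]| = 1.
Proof. by rewrite normc_def /= expr0n expr1n add0r sqrtr1. Qed.

Lemma cvgn_complex u : cvgn (fun n => complex.Re (u n)) ->
  cvgn (fun n => complex.Im (u n)) -> cvgn u.
Proof.
set x := limn (fun n => complex.Re (u n)).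
set y := limn (fun n => complex.Im (u n)) => hx hy.
apply/cvg_ex; exists (x +i* y).
apply: (@cvgn_dist R[i]) => e e0.
(* A positive complex number is real, so [e] splits into two real halves, one for each
   coordinate. *)
have [d d0 ed] : exists2 d : R, 0 < d & e = (d + d)%:C.
  case: e e0 => a b; rewrite ltcE /= => /andP[/eqP -> a0].
  by exists (a / 2); [rewrite divr_gt0 | rewrite -splitr].
have {}hx : \forall n \near \oo, `|x - complex.Re (u n)| < d by move/cvgrPdist_lt : hx; apply.
have {}hy : \forall n \near \oo, `|y - complex.Im (u n)| < d by move/cvgrPdist_lt : hy; apply.
near=> n.
have -> : x +i* y - u n = (x - complex.Re (u n))%:C + 'i * (y - complex.Im (u n))%:C.
  by case: (u n) => a b; simpc.
rewrite ed (le_lt_trans (ler_normD _ _))// [ltRHS]rmorphD/= ltrD//.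
  by rewrite normc_def /= expr0n addr0 sqrtr_sqr ltcR; near: n.
rewrite normrM normc_i mul1r normc_def /= expr0n addr0 sqrtr_sqr ltcR; near: n.
Unshelve. all: by end_near. Qed.

(** Real and imaginary parts are each compared with a real geometric series. *)
Lemma cvgn_geometric_dominated u C r : 0 <= r < 1 ->
  (forall n, `|u n| <= (C * r ^+ n)%:C) -> cvgn (fun N => \sum_(n < N) u n).
Proof.
move=> /andP[r0 r1] hu.
have bounded_cvg (f : {additive R[i] -> R}) : (forall z, `|f z|%:C <= `|z|) ->
    cvgn (fun N => f (\sum_(n < N) u n)).
  move=> hf.
  have -> : (fun N => f (\sum_(n < N) u n)) = series (fun n => f (u n)).
    by apply/funext => N; rewrite raddf_sum /series /= big_mkord.
  apply: normed_cvg.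
  have fC n : `|f (u n)| <= C * r ^+ n.
    by rewrite -lecR; exact: le_trans (hf _) (hu n).
  apply: (@series_le_cvg _ _ (geometric C r)) => //.
    by move=> n; exact: normr_ge0.
    by move=> n; exact: le_trans (normr_ge0 _) (fC n).
  by apply: is_cvg_geometric_series; rewrite ger0_norm.
apply: cvgn_complex; apply: bounded_cvg => z.
  exact: normc_ge_Re.
(* Up to sign, [Im z] is the real part of ['i * z]. *)
have := normc_ge_Re ('i * z); rewrite normrM normc_i mul1r.
by case: z => a b; rewrite /= mul0r mul1r sub0r normrN.
Qed.

(** Since [1 + x <= exp x], the product is at most the exponential of a geometric sum, itself at
    most [C / (1 - r)]. *)
Lemma prod_geometric_bounded a C r : 0 <= r < 1 ->
  (forall n, `|a n| <= (C * r ^+ n)%:C) ->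
  exists D, forall N, `|\prod_(n < N) (1 + a n)| <= D%:C.
Proof.
move=> /andP[r0 r1] ha; exists (expR (C / (1 - r))) => N.
have C0 : 0 <= C.
  by have := le_trans (normr_ge0 _) (ha 0%N); rewrite expr0 mulr1 lecR.
apply: (@le_trans _ _ (expR (\sum_(n < N) C * r ^+ n))%:C); last first.
  have -> : \sum_(n < N) C * r ^+ n = series (geometric C r) N.
    by rewrite /series /= big_mkord.
  rewrite lecR ler_expR geometric_seriesE ?lt_eqF//.
  apply: ler_wpM2r; first by rewrite invr_ge0 subr_ge0 ltW.
  by apply: ler_piMr => //; rewrite lerBlDr lerDl exprn_ge0.
rewrite expR_sum normr_prod rmorph_prod /=; apply: ler_prod => n _.
rewrite normr_ge0 (le_trans (ler_normD _ _))// normr1.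
apply: (@le_trans _ _ (1 + C * r ^+ n)%:C); last by rewrite lecR expR_ge1Dx.
by rewrite rmorphD /= lerD2l.
Qed.

(** As [P_(N+1) - P_N = P_N a_N], the product is a series, geometrically dominated once the [P_N]
    are bounded. *)
Lemma cvgn_prod_geometric a C r : 0 <= r < 1 ->
  (forall n, `|a n| <= (C * r ^+ n)%:C) ->
  cvgn (fun N => \prod_(n < N) (1 + a n)).
Proof.
move=> r01 ha; have [D hD] := prod_geometric_bounded r01 ha.
set P := fun N => \prod_(n < N) (1 + a n).
have hP : cvgn (fun N => \sum_(n < N) P n * a n).
  apply: (@cvgn_geometric_dominated (fun n => P n * a n) (D * C) r) => // n.
  rewrite normrM -mulrA rmorphM /=; apply: ler_pM => //; exact: hD.
have -> : P = fun N => 1 + \sum_(n < N) P n * a n.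
  apply/funext => N; rewrite /P; elim: N => [|N IH].
    by rewrite !big_ord0 addr0.
  by rewrite big_ord_recr [in RHS]big_ord_recr /= addrA -IH; ring.
move/cvg_ex : hP => [l hl]; apply/cvg_ex; exists (1 + l).
exact: (@cvgn_addl R[i]).
Qed.

End ComplexConvergence.

(** * Convergence for [|q| < 1] and conclusion *)

Theorem theorem1p1 (R : realType) (q : R[i]) (k : nat)
    (hq : `|q| < 1) (hk : (1 <= k)%N) :
  let s := fun N : nat => \sum_(k.+1 <= n < N)
    (qpoch (- q) q k * qpoch (- 1) q (n - k) * q ^+ (k.+1 * n) / qpoch q q n
     * qbinom q n.-1 k) in
  cvgn s /\
  qpoch_inf (- q) q / qpoch_inf q q
    * (1 + 2 * \sum_(1 <= j < k.+1) (-1) ^+ j * q ^+ (j ^ 2))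
  = 1 + (-1) ^+ k * limn s.
Proof.
move=> s.
have [r hr] : exists r : R, `|q| = r%:C by rewrite normc_def; eexists.
have r0 : 0 <= r by rewrite -lecR -hr; exact: normr_ge0.
have r1 : r < 1 by rewrite -ltcR -hr; exact: hq.
have r01 : 0 <= r < 1 by rewrite r0.
have hX n : `|q ^+ n| = (r ^+ n)%:C by rewrite normrX hr rmorphXn.
(* [w] will bound every [1 / (1 - q^n)] with [n > 0], because [|1 - q^n| >= 1 - r^n >= 1 - r]. *)
pose w := (1 - r)^-1.
have w0 : 0 <= w by rewrite invr_ge0 subr_ge0 ltW.
have hden n : (0 < n)%N -> (1 - r)%:C <= `|1 - q ^+ n|.
  move=> n0; apply: le_trans (lerB_normD _ _); rewrite normr1 normrN hX.
  rewrite -(rmorph1 (real_complex R)) -rmorphB lecR lerB// -[leRHS]expr1.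
  by apply: ler_wiXn2l => //; exact: ltW.
have hq0 n : (0 < n)%N -> 1 - q ^+ n != 0.
  move=> n0; rewrite -normr_gt0 (lt_le_trans _ (hden _ n0))//.
  by rewrite ltcR subr_gt0.
have hinv n : (0 < n)%N -> `|(1 - q ^+ n)^-1| <= w%:C.
  move=> n0; rewrite normfV /w fmorphV /= lef_pV2 ?hden// posrE.
    by rewrite normr_gt0 hq0.
  by rewrite ltcR subr_gt0.
have num_bound n : `|q ^+ n.+1| <= (1 * r ^+ n)%:C.
  by rewrite hX lecR mul1r exprS ler_piMl ?exprn_ge0// ltW.
have den_bound n : `|- q ^+ n.+1| <= (1 * r ^+ n)%:C by rewrite normrN.
have inv_bound n : `|q ^+ n.+1 / (1 - q ^+ n.+1)| <= (w * r ^+ n)%:C.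
  rewrite normrM mulrC rmorphM /=; apply: ler_pM => //; first exact: hinv.
  by rewrite -[r ^+ n]mul1r.
have numE N : qpoch (- q) q N = \prod_(n < N) (1 + q ^+ n.+1).
  by apply: eq_bigr => i _; rewrite mulNr opprK -exprS.
have denE N : qpoch q q N = \prod_(n < N) (1 + - q ^+ n.+1).
  by apply: eq_bigr => i _; rewrite -exprS.
(* The reciprocals are again products of factors [1 + a_n], so the same lemmas give their
   convergence and a uniform bound. *)
have invE N : (qpoch q q N)^-1 =
    \prod_(n < N) (1 + q ^+ n.+1 / (1 - q ^+ n.+1)).
  rewrite denE -prodfV; apply: eq_bigr => i _.
  by have h := hq0 _ (ltn0Sn i); field.
have /cvg_ex[P hP] : cvgn (qpoch (- q) q).
  by rewrite (funext numE); exact: (cvgn_prod_geometric r01 num_bound).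
have /cvg_ex[Q hQ] : cvgn (qpoch q q).
  by rewrite (funext denE); exact: (cvgn_prod_geometric r01 den_bound).
have /cvg_ex[Q' hQ'] : cvgn (fun N => (qpoch q q N)^-1).
  by rewrite (funext invE); exact: (cvgn_prod_geometric r01 inv_bound).
(* The limit of the reciprocals shows [Q != 0], so the quotient in the statement is a genuine
   one. *)
have QQ' : Q * Q' = 1.
  apply: (@cvgn_unique R[i] (fun N => qpoch q q N * (qpoch q q N)^-1)).
    exact (@cvgn_mul R[i] _ _ _ _ hQ hQ').
  have -> : (fun N => qpoch q q N * (qpoch q q N)^-1) = fun=> 1.
    by apply/funext => N; rewrite divff// qpoch_neq0.
  exact: cvg_cst.
have Q0 : Q != 0 by apply: contra_eq_neq QQ' => ->; rewrite mul0r eq_sym oner_eq0.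
have Q'E : Q' = Q^-1 by apply: (mulfI Q0); rewrite QQ' divff.
have hc : qratio q @ \oo --> P / Q by rewrite -Q'E; exact (@cvgn_mul R[i] _ _ _ _ hP hQ').
have [D hD] : exists D : R, forall n, `|qratio q n| <= D%:C.
  have [D1 h1] := prod_geometric_bounded r01 num_bound.
  have [D2 h2] := prod_geometric_bounded r01 inv_bound.
  exists (D1 * D2) => n; rewrite /qratio normrM rmorphM /= numE invE.
  by apply: ler_pM.
have hF i j : (0 < i)%N -> (0 < j)%N -> cvgn (lambert_sum q i j).
  (* Here [i > 0] gives [|q^(i n)| <= r^n], while [D] and [w] bound the other two factors. *)
  move=> i0 j0; apply: (@cvgn_geometric_dominated R
    (fun m => qratio q m * q ^+ (i * m) / (1 - q ^+ (m + j))) (D * w) r) => // n.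
  have -> : (D * w * r ^+ n)%:C = D%:C * (r ^+ n)%:C * w%:C.
    by rewrite -!rmorphM mulrAC.
  rewrite normrM [`|qratio q n * _|]normrM.
  apply: ler_pM => //; last by rewrite hinv// addn_gt0 j0 orbT.
  apply: ler_pM => //.
  by rewrite hX lecR ler_wiXn2l ?leq_pmull// ltW.
have hs : s @ \oo --> 2 * qratio q k * q ^+ (k.+1 ^ 2)
    * limn (lambert_sum q k.+1 k.+1).
  exact (@summand_cvg R[i] q hq0 hF k).
split; first by apply/cvg_ex; eexists; exact: hs.
rewrite (@cvgn_lim R[i] _ _ hs) (@theta_lambert R[i] q (P / Q) hq0 hc hF).
by rewrite /qpoch_inf (@cvgn_lim R[i] _ _ hP) (@cvgn_lim R[i] _ _ hQ).
Qed.
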